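(* Let $n,N\ge 1$ be integers and $t_0\in\mathbb{R}$. For $k=1,\dots,n$ let $F_k(t,u_{11},\dots,u_{1N},\dots,u_{n1},\dots,u_{nN})$ be a real-valued function on $[t_0,+\infty)\times\mathbb{R}^{nN}$, locally integrable in $t$ and continuous in $(u_{11},\dots,u_{nN})$. For $k=1,\dots,n$, $j=1,\dots,N$ let $\alpha_{kj}$ be a real-valued locally measurable function on $[t_0,+\infty)$, and for $k=1,\dots,n$ let $r_k$ be a real-valued continuous function on $(-\infty,t_0]$. Assume: (L) there are locally integrable functions $f_1,\dots,f_n$ on $[t_0,+\infty)$ such that, for $k=1,\dots,n$, all $t\ge t_0$ and all $u_{mj},v_{mj}\in\mathbb{R}$, $$|F_k(t,u_{11},\dots,u_{nN})-F_k(t,v_{11},\dots,v_{nN})|\le f_k(t)\sum_{m=1}^n\sum_{j=1}^N|u_{mj}-v_{mj}|;$$ (LI) for any locally measurable functions $\psi_{11},\dots,\psi_{1N},\dots,\psi_{n1},\dots,\psi_{nN}$ on $[t_0,+\infty)$, the superpositions $t\mapsto F_k(t,\psi_{11}(t),\dots,\psi_{nN}(t))$, $k=1,\dots,n$, are locally integrable on $[t_0,+\infty)$; (Ret) $\alpha_{kj}(t)\le t$ for all $t\ge t_0$, $k=1,\dots,n$, $j=1,\dots,N$. Then the Cauchy problem $$\phi_k'(t)=F_k\bigl(t,\phi_1(\alpha_{11}(t)),\dots,\phi_1(\alpha_{1N}(t)),\dots,\phi_n(\alpha_{n1}(t)),\dots,\phi_n(\alpha_{nN}(t))\bigr),\quad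 t\ge t_0,\ k=1,\dots,n,$$ $$\phi_k(t)=r_k(t),\quad t\le t_0,\ k=1,\dots,n,$$ has a unique solution.
   Context: A solution of the Cauchy problem is a real-valued continuous vector function $(\phi_1(t),\dots,\phi_n(t))$ on $\mathbb{R}$ which is absolutely continuous on every compact subinterval of $[t_0,+\infty)$, satisfies the system of equations for almost every $t\in[t_0,+\infty)$, and satisfies the initial conditions $\phi_k(t)=r_k(t)$ for all $t\le t_0$, $k=1,\dots,n$. ''Locally measurable'' and ''locally integrable'' mean Lebesgue measurable, respectively Lebesgue integrable, on every compact subinterval. *)

(* Defs.v *)
From HB Require Import structures.
From mathcomp Require Import all_boot all_order all_algebra.
From mathcomp Require Import all_classical all_reals all_analysis.

Set Implicit Arguments.
Unset Strict Implicit.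
Unset Printing Implicit Defensive.
Import Order.TTheory GRing.Theory Num.Theory.
Import numFieldNormedType.Exports.
Local Open Scope classical_set_scope.
Local Open Scope ring_scope.

(* The library's default sigma-algebra on [R] is the Borel one. "Lebesgue
   measurable" refers to its completion, i.e. the Caratheodory sigma-algebra of
   the Lebesgue outer measure, which is the one underlying
   [completed_lebesgue_measure]. *)
Definition lebesgueTypeR (R : realType) : measurableType _ :=
  caratheodory_type ((@wlength R idfun)^*)%mu.

Section local_notions.
Context {R : realType}.

(* Functions "on [t0, +oo)" are total functions on [R] whose values to the left
   of [t0] are unconstrained and never used. *)
Definition locally_measurable_from (t0 : R) (f : R -> R) : Prop :=
  forall a b, t0 <= a -> a <= b ->
    measurable_fun (`[a, b]%classic : set (lebesgueTypeR R)) f.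

Definition locally_integrable_from (t0 : R) (f : R -> R) : Prop :=
  forall a b, t0 <= a -> a <= b ->
    (@completed_lebesgue_measure R).-integrable `[a, b] (EFin \o f).

Definition absolutely_continuous_on (a b : R) (f : R -> R) : Prop :=
  forall e : R, 0 < e -> exists2 d : R, 0 < d &
    forall (p : nat) (x y : 'I_p -> R),
      (forall i, [/\ a <= x i, x i <= y i & y i <= b]) ->
      trivIset setT (fun i => `]x i, y i[%classic) ->
      \sum_(i < p) (y i - x i) < d ->
      \sum_(i < p) `|f (y i) - f (x i)| < e.

End local_notions.

(* The arguments u_{mj} of the right-hand sides are the entries of an n x N
   matrix, whose topology is that of R^{nN}. *)
Definition cauchy_solution (R : realType) (n N : nat) (t0 : R)
    (F : 'I_n -> R -> 'M[R]_(n, N) -> R)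
    (alpha : 'I_n -> 'I_N -> R -> R) (r : 'I_n -> R -> R)
    (phi : 'I_n -> R -> R) : Prop :=
  [/\ forall k, continuous (phi k),
      forall k a b, t0 <= a -> a <= b -> absolutely_continuous_on a b (phi k),
      {ae (@completed_lebesgue_measure R), forall t : R, t0 <= t -> forall k,
        is_derive t 1 (phi k)
          (F k t (\matrix_(m < n, j < N) phi m (alpha m j t)))}
    & forall k t, t <= t0 -> phi k t = r k t].

(* Main.v *)
Require Import Defs.
From HB Require Import structures.
From mathcomp Require Import all_boot all_order all_algebra.
From mathcomp Require Import all_classical all_reals all_analysis.
From mathcomp Require Import measurable_realfun lra ring.

(** Why the theorem is true.  Say that Phi is a Picard image of a continuous
    phi when Phi solves the system obtained by substituting phi, instead of
    the unknown, into the delayed right-hand sides; the solutions of the Cauchy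
    problem are exactly the fixed points of this relation.  The proof is a
    contraction argument for it.

    Picard images exist ([picard_image_exists]): the right-hand side is locally
    integrable by (LI), and a locally integrable function has an absolutely
    continuous primitive, differentiable almost everywhere with the expected
    derivative ([primitive_exists]).  This is the Lebesgue differentiation
    theorem, transferred from Borel functions to Lebesgue measurable ones by
    modifying the integrand on a Borel null set.

    From there on no integral is needed.  All estimates come from one fact: an
    absolutely continuous function whose derivative is nonnegative almost
    everywhere is nondecreasing ([absolutely_continuous_nondecreasing]).

    Contraction is measured against the weight w = exp (2nN G), where G is a
    primitive of f_1 + ... + f_n.  Suppose |phi - psi| <= C w on (-oo, T].
    Since w is nondecreasing and the arguments are retarded, (L) bounds the
    a.e. derivative of the difference of the k-th components of the images by
    nN C f_k w, which is at most the derivative of (C / 2) w.  So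
    |Phi - Psi| <= (C / 2) w on (-oo, T]  ([picard_image_contraction]).
    Iterating gives uniqueness, because two solutions differ by at most
    (C / 2^p) w for every p, and existence, because the Picard iterates
    converge uniformly on every half-line (-oo, T].  Working with half-lines
    and a weight that is defined on the whole line avoids any continuation of
    local solutions. *)

Set Implicit Arguments.
Unset Strict Implicit.
Unset Printing Implicit Defensive.
Import Order.TTheory GRing.Theory Num.Theory.
Import numFieldNormedType.Exports.
Local Open Scope classical_set_scope.
Local Open Scope ring_scope.

(** * Null sets of the completed Lebesgue measure *)

(** A null set of the completion is a Borel set plus a subset of a Borel null
    set, hence is contained in a Borel null set.  This lets results about the
    Borel measure be used for the completed one, and conversely. *)
Lemma completed_negligible (R : realType) (N : set R) :
  (@completed_lebesgue_measure R).-negligible N <->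
  (@lebesgue_measure R).-negligible N.
Proof.
split=> -[A [mA A0 NA]]; last first.
  by exists A; split => //; exact: sub_caratheodory.
move: mA; rewrite -[X in X A -> _]completed_caratheodory_measurable.
rewrite g_sigma_completed_algebra_genE => -[X mX [Z negZ AE]].
have X0 : lebesgue_measure X = 0%E.
  apply/eqP; rewrite eq_le measure_ge0 andbT -A0.
  by apply: le_outer_measure; rewrite -AE; exact: subsetUl.
apply: (@negligibleS _ (measurableTypeR R) _ _ (A : set R) N NA); rewrite -AE.
apply: negligibleU; last exact: negZ.
by exists X; split.
Qed.

Lemma completed_ae2 (R : realType) (P Q S : R -> Prop) :
  {ae @completed_lebesgue_measure R, forall t : R, P t} ->
  {ae @completed_lebesgue_measure R, forall t : R, Q t} ->
  (forall t, P t -> Q t -> S t) ->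
  {ae @completed_lebesgue_measure R, forall t : R, S t}.
Proof.
move=> aeP aeQ PQS; apply: negligibleS (negligibleU aeP aeQ) => t /= St.
by apply: contrapT => /not_orP[/contrapT Pt /contrapT Qt]; exact/St/PQS.
Qed.

Lemma completed_ae_neq (R : realType) (a : R) :
  {ae @completed_lebesgue_measure R, forall t : R, t != a}.
Proof.
apply/completed_negligible; exists [set a]; split.
- exact: measurable_set1.
- exact: lebesgue_measure_set1.
- by move=> t /= /negP; rewrite negbK => /eqP.
Qed.

Lemma completed_ae_forall (R : realType) (n : nat) (P : 'I_n -> R -> Prop) :
  (forall k, {ae @completed_lebesgue_measure R, forall t : R, P k t}) ->
  {ae @completed_lebesgue_measure R, forall t : R, forall k, P k t}.
Proof.
move=> aeP.
pose N (i : nat) := if insub i is Some k then ~` [set t | P k t] else set0.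
have negN i : (@completed_lebesgue_measure R).-negligible (N i).
  by rewrite /N; case: insubP => [k _ _|_]; [exact: aeP|exact: negligible_set0].
apply: negligibleS (negligible_bigcup negN) => t /= /existsNP[k nPk].
by exists (val k) => //; rewrite /N valK.
Qed.

Lemma borel_off_null (R : realType) (A : set (lebesgueTypeR R)) :
  measurable A -> exists Z : set R,
    [/\ measurable Z, lebesgue_measure Z = 0%E &
        measurable (A `\` Z : set (measurableTypeR R))].
Proof.
rewrite -[X in X A -> _]completed_caratheodory_measurable.
rewrite g_sigma_completed_algebra_genE => -[X mX [N [Z [mZ Z0 NZ]] <-]].
exists Z; split => //.
rewrite setDUl (_ : N `\` Z = set0) ?setU0; first exact: measurableD.
by rewrite -subset0 => x [/NZ].
Qed.

(** The null set works for all rational half-lines ]-oo, q[ simultaneously;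
    the preimage of any other open half-line is a countable union of
    preimages of those. *)
Lemma measurable_fun_borel_off_null (R : realType) (D : set R)
    (f : R -> R) :
  measurable (D : set (measurableTypeR R)) ->
  measurable_fun (D : set (lebesgueTypeR R)) f ->
  exists Z : set R, [/\ measurable Z, lebesgue_measure Z = 0%E &
    measurable_fun (D `\` Z : set (measurableTypeR R)) f].
Proof.
move=> mD mf.
have mDL : measurable (D : set (lebesgueTypeR R)) by exact: sub_caratheodory.
pose A (q : rat) := D `&` f @^-1` `]-oo, ratr q[.
have mA q : measurable (A q : set (lebesgueTypeR R)).
  by apply: mf => //; exact: measurable_itv.
have /choice[Zq ZqP] := fun q => borel_off_null (mA q).
have negZ : (@lebesgue_measure R).-negligible (\bigcup_q Zq q).
  (* Countable unions of null sets are indexed by nat: enumerate rat. *)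
  have [e be] : exists e : nat -> rat, forall q, exists n, e n = q.
    exists (fun n => odflt 0 (unpickle n)) => q.
    by exists (pickle q); rewrite pickleK.
  apply: (@negligibleS _ (measurableTypeR R) _ _ (\bigcup_n Zq (e n))).
    by move=> x [q _ Zx]; have [n en] := be q; exists n => //; rewrite en.
  apply: negligible_bigcup => n; have [mZ Z0 _] := ZqP (e n).
  by exists (Zq (e n)); split.
have [Z [mZ Z0 sZ]] := negZ.
exists Z; split => //.
apply: (measurability _ (RGenInftyO.measurableE R)) => // _ [_ [r ->] <-].
rewrite (_ : _ `&` _ = \bigcup_(q in [set q : rat | ratr q < r]) (A q `\` Z)).
  rewrite bigcup_mkcond; apply: bigcupT_measurable_rat => q.
  case: ifP => // _.
  have [mZq _ mAZ] := ZqP q.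
  rewrite (_ : A q `\` Z = (A q `\` Zq q) `\` Z); first exact: measurableD.
  apply/seteqP; split => x [Ax Zx]; last by case: Ax => Ax _; split.
  by split => //; split => // Zqx; apply: Zx; apply: sZ; exists q.
apply/seteqP; split => [x [[Dx Zx]] | x [q /= qr [[Dx fx] Zx]]].
  rewrite /= in_itv/= => fxr.
  have [q] := rat_in_itvoo fxr; rewrite in_itv/= => /andP[q1 q2].
  by exists q => //; split => //; split => //=; rewrite in_itv.
split; first by split.
by move: fx; rewrite /= !in_itv/= => /lt_trans; apply.
Qed.

(** * Primitives of locally integrable functions *)

(** The Borel measure is the push-forward of the completed one along the
    identity map, which is measurable from the larger sigma-algebra to the
    smaller one. *)
Lemma ge0_integral_completed (R : realType)
    (D : set (measurableTypeR R)) (h : measurableTypeR R -> \bar R) :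
  measurable D ->
  measurable_fun D h ->
  (forall x, 0 <= h x)%E ->
  (\int[@lebesgue_measure R]_(x in D) h x =
   \int[@completed_lebesgue_measure R]_(x in D) h x)%E.
Proof.
move=> mD mh h0.
pose idm : lebesgueTypeR R -> measurableTypeR R := idfun.
have mid : measurable_fun setT idm.
  by move=> _ A mA; rewrite setTI; exact: sub_caratheodory.
rewrite -[RHS](@ge0_integral_pushforward _ _ _ _ R idm mid
  (@completed_lebesgue_measure R) D h mD mh) //.
Qed.

Lemma measurable_fun_lebesgue d (U : measurableType d) (R : realType)
    (D : set R) (h : R -> U) :
  measurable_fun (D : set (measurableTypeR R)) h ->
  measurable (D : set (measurableTypeR R)) ->
  measurable_fun (D : set (lebesgueTypeR R)) h.
Proof. by move=> mh mD _ A mA; apply: sub_caratheodory; exact: mh. Qed.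

(** The version is set to 0 on the left of [t0], so that it is integrable on
    every half-line [`]-oo, y]]: its primitive can then start at -oo and be
    absolutely continuous on all intervals, whatever their position with
    respect to [t0]. *)
Lemma locally_integrable_borel_version (R : realType) (t0 : R) (f : R -> R) :
  locally_integrable_from t0 f -> exists g : R -> R,
  [/\ measurable_fun (setT : set (measurableTypeR R)) g,
      forall t, t <= t0 -> g t = 0,
      forall y, (@lebesgue_measure R).-integrable `]-oo, y] (EFin \o g) &
      {ae @completed_lebesgue_measure R, forall t : R, t0 < t -> g t = f t}].
Proof.
move=> fi.
have fm : measurable_fun (`]t0, +oo[%classic : set (lebesgueTypeR R)) f.
  apply: (@measurable_funS _ _ (lebesgueTypeR R) _
    (\bigcup_n `[t0, t0 + n%:R]%classic)).
  - apply: bigcupT_measurable => n.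
    by apply: sub_caratheodory; exact: measurable_itv.
  - move=> x /=; rewrite in_itv/= andbT => tx.
    exists (Num.truncn (x - t0)).+1 => //=.
    rewrite in_itv/= (ltW tx)/= -lerBlDl.
    by apply/ltW/truncnS_gt.
  - apply/measurable_fun_bigcup => n.
      by apply: sub_caratheodory; exact: measurable_itv.
    have tn : t0 <= t0 + n%:R by rewrite lerDl.
    by have /integrableP[/measurable_EFinP] := fi _ _ (lexx t0) tn.
have mI : measurable (`]t0, +oo[%classic : set (measurableTypeR R)).
  exact: measurable_itv.
have [Z [mZ Z0 mfZ]] := measurable_fun_borel_off_null mI fm.
set D := _ `\` Z in mfZ.
have mD : measurable (D : set (measurableTypeR R)) by exact: measurableD.
exists (f \_ D).
have mg : measurable_fun (setT : set (measurableTypeR R)) (f \_ D).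
  exact/(measurable_restrictT _ mD).
split => //.
- move=> t tt0; rewrite patchE memNset// => -[]/=.
  by rewrite in_itv/= andbT ltNge tt0.
- move=> y; apply/integrableP; split.
    by apply/measurable_EFinP; exact: measurable_funTS.
  pose y' := Num.max t0 y.
  have t0y' : t0 <= y' by rewrite le_max lexx.
  have /integrableP[mfi] := fi t0 y' (lexx _) t0y'.
  apply: le_lt_trans.
  rewrite ge0_integral_completed//=; last first.
    apply/measurable_EFinP; apply: measurableT_comp => //.
    exact: measurable_funTS.
  rewrite integral_mkcond [leRHS]integral_mkcond.
  apply: ge0_le_integral => //.
  + by move=> x _; rewrite patchE; case: ifP.
  + apply: measurable_fun_lebesgue; last exact: measurableT.
    apply/(measurable_restrictT _ (measurable_itv _)).
    apply/measurable_EFinP; apply: measurableT_comp => //.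
    exact: measurable_funTS.
  + have mI' : measurable (`[t0, y']%classic : set (lebesgueTypeR R)).
      by apply: sub_caratheodory; exact: measurable_itv.
    apply/(measurable_restrictT _ mI').
    apply/measurable_EFinP; apply: measurableT_comp => //.
    exact/measurable_EFinP.
  + move=> x _; rewrite !patchE.
    case: ifPn => [xy|_]; last by case: ifP; rewrite ?lee_fin.
    case: (boolP (x \in D)) => [xD|_]; last first.
      by rewrite normr0; case: ifP; rewrite ?lee_fin.
    rewrite ifT// inE/= in_itv/=.
    move: xy xD; rewrite !inE/= in_itv/= => xy [/=].
    by rewrite in_itv/= andbT => tx _; rewrite ltW//= le_max xy orbT.
- exists Z; split.
  + exact: sub_caratheodory.
  + exact: Z0.
  + move=> t /=; apply: contra_notP => Zt tt; rewrite patchE mem_set//.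
    by split => //=; rewrite in_itv/= tt.
Qed.

Local Notation lebesgue := (@lebesgue_measure _).

(** Absolute continuity of the integral with respect to the measure, applied to
    the union of the given intervals.  The cut-off at [b] makes the integrand
    integrable on the whole line. *)
Lemma absolutely_continuous_integral (R : realType) (g : R -> R) (a b : R) :
  (forall y, lebesgue.-integrable `]-oo, y] (EFin \o g)) ->
  absolutely_continuous_on a b
    (fun t => \int[lebesgue]_(x in `]-oo, t]) g x).
Proof.
move=> gi e e0.
set gb := g \_ `]-oo, b].
have gbi : lebesgue.-integrable setT (EFin \o gb).
  by rewrite /gb -restrict_EFin; apply/integrable_restrict; rewrite ?setTI.
have [d [d0 H]] := integral_normr_continuous gbi e0.
exists d => // p x y xy tI xyd.
pose I (i : 'I_p) := `]x i, y i[%classic.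
have mI i : measurable (I i : set (measurableTypeR R)) by exact: measurable_itv.
pose A := \big[setU/set0]_(i < p) I i.
have mA : measurable (A : set (measurableTypeR R)) by exact: bigsetU_measurable.
have muA : lebesgue A = (\sum_(i < p) (y i - x i))%:E.
  rewrite /A measure_bigsetU_ord//= -sumEFin; apply: eq_bigr => i _.
  have [_ xyi _] := xy i.
  rewrite [LHS]lebesgue_measure_itv/= lte_fin; case: ltP => // yx.
  by rewrite (_ : y i = x i) ?subrr//; apply/eqP; rewrite eq_le yx.
have gbn : lebesgue.-integrable setT (EFin \o (fun x => `|gb x|)).
  exact: (integrable_norm gbi).
have gbS (B : set R) : measurable (B : set (measurableTypeR R)) ->
    lebesgue.-integrable B (EFin \o (fun x => `|gb x|)).
  by move=> mB; exact: integrableS gbn.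
have AE : \int[lebesgue]_(x in A) `|gb x| =
    \sum_(i < p) \int[lebesgue]_(x in I i) `|gb x|.
  rewrite /Rintegral /A ge0_integral_bigsetU//=.
  - by rewrite sum_fine//; move=> i _; exact: integrable_fin_num (gbS _ _).
  - exact: index_enum_uniq.
  - exact: sub_trivIset tI.
  - by case/integrableP : (gbS _ mA).
apply: le_lt_trans (H A mA _); last by rewrite [X in (X < _)%E]muA lte_fin.
rewrite AE; apply: ler_sum => i _; have [axi xyi yib] := xy i.
rewrite (@Rintegral_itvB _ g -oo%O (BRight (y i)) (x i))//=.
have gxy : lebesgue.-integrable `]x i, y i[ (EFin \o g).
  apply: integrableS (gi (y i)) => //=; apply: subset_itv => //.
  by rewrite bnd_simp.
rewrite -Rintegral_itv_bndo_bndc//.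
apply: (le_trans (le_normr_Rintegral _ gxy)) => //.
rewrite le_eqVlt; apply/orP; left; apply/eqP/eq_Rintegral => z.
rewrite inE/= in_itv/= => /andP[_ zy]; rewrite /gb patchE mem_set//.
by rewrite /= in_itv/= (le_trans (ltW zy)).
Qed.

(** The sequel uses Lebesgue integration only through these three
    properties of a primitive. *)
Lemma primitive_exists (R : realType) (t0 : R) (f : R -> R) :
  locally_integrable_from t0 f -> exists P : R -> R,
  [/\ forall t, t <= t0 -> P t = 0,
      forall a b, absolutely_continuous_on a b P &
      {ae @completed_lebesgue_measure R,
        forall t : R, t0 < t -> is_derive t 1 P (f t)}].
Proof.
move=> /locally_integrable_borel_version[g [mg g0 gi gf]].
exists (fun t => \int[lebesgue]_(x in `]-oo, t]) g x); split.
- move=> t tt0; rewrite /Rintegral integral0_eq// => x /=.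
  by rewrite in_itv/= => xt; rewrite g0//; exact: le_trans tt0.
- by move=> a b; exact: absolutely_continuous_integral.
have gloc : locally_integrable setT g.
  split => //; first exact: openT.
  move=> K _ cK.
  have [M [_ HM]] := compact_bounded cK.
  have KM : K `<=` `]-oo, M + 1].
    move=> x /(HM (M + 1)); rewrite ltrDl ltr01 => /(_ isT) xM.
    by rewrite /= in_itv/= (le_trans (ler_norm _)).
  have /integrableP[mfi] := gi (M + 1).
  apply: le_lt_trans; apply: ge0_subset_integral => //=.
  - exact: compact_measurable.
  - by apply/measurable_EFinP; apply: measurableT_comp => //;
      exact: measurable_funTS.
have := FTC1Ny gi gloc.
move=> /completed_negligible aeP.
apply: (completed_ae2 gf aeP) => t gft [dP eP] tt.
by rewrite -gft// -eP derive1E; exact: DeriveDef.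
Qed.

(** * Absolutely continuous functions *)

(** Cousin's lemma as an induction principle: a tagged partition of [`[a, b]]
    finer than the gauge [d] exists, and additivity propagates [P] along it.
    The proof takes the supremum of the points reachable from [a]. *)
Lemma interval_additive_induction (R : realType) (P : R -> R -> Prop)
    (a b : R) : a <= b ->
  (forall u v w, u <= v -> v <= w -> P u v -> P v w -> P u w) ->
  (forall x, a <= x <= b -> exists2 d, 0 < d &
    forall u v, a <= u -> u <= x -> x <= v -> v <= b -> v - u < d -> P u v) ->
  P a b.
Proof.
move=> ab Padd Ploc.
pose S := [set x | a <= x <= b /\ P a x].
have Sa : S a.
  have [|d d0 H] := Ploc a; first by rewrite lexx.
  by split; [rewrite lexx|apply: H; rewrite ?lexx// subrr].
have Sub : ubound S b by move=> x [/andP[]].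
have hS : has_sup S by split; [exists a|exists b].
set s := sup S.
have as_ : a <= s by apply: ub_le_sup => //; exists b.
have sb : s <= b by apply: ge_sup => //; exists a.
have [|d d0 H] := Ploc s; first by rewrite as_.
have [y [/andP[ay yb] Pay] yd] : exists2 y, S y & s - d / 2 < y.
  by apply: sup_adherent => //; rewrite divr_gt0.
have ys : y <= s by apply: ub_le_sup; [exists b|split => //; rewrite ay].
have Pas v : s <= v -> v <= b -> v - s < d / 2 -> P a v.
  move=> sv vb vd; apply: (Padd _ y) => //; first exact: le_trans sv.
  by apply: H => //; lra.
have [sb'|sb'] := leP b s; first by apply: Pas => //; lra.
pose v := Num.min b (s + d / 4).
have sv : s < v by rewrite lt_min sb'/=; lra.
have vb : v <= b by rewrite ge_min lexx.
have vd : v <= s + d / 4 by rewrite ge_min lexx orbT.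
have : v <= s.
  apply: ub_le_sup; first by exists b.
  split; first by rewrite vb andbT; lra.
  by apply: Pas => //; lra.
by rewrite leNgt sv.
Qed.

(** Covers at once sums, differences, multiples and Lipschitz images of
    absolutely continuous functions, by a suitable choice of [f], [g], [K]. *)
Lemma absolutely_continuous_dominated (R : realType) (a b K : R)
    (f g h : R -> R) : 0 <= K ->
  absolutely_continuous_on a b f -> absolutely_continuous_on a b g ->
  (forall x y, a <= x -> x <= y -> y <= b ->
    `|h y - h x| <= K * (`|f y - f x| + `|g y - g x|)) ->
  absolutely_continuous_on a b h.
Proof.
move=> K0 acf acg hfg e e0.
pose e' := e / 2 / (K + 1).
have e'0 : 0 < e' by rewrite !divr_gt0//; lra.
have [d1 d10 H1] := acf _ e'0; have [d2 d20 H2] := acg _ e'0.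
exists (Num.min d1 d2); first by rewrite lt_min d10.
move=> p x y xy tI; rewrite lt_min => /andP[/(H1 _ _ _ xy tI) s1].
move=> /(H2 _ _ _ xy tI) s2.
apply: (@le_lt_trans _ _ (K * (e' + e'))); last first.
  have -> : e' + e' = e / (K + 1) by rewrite /e' -mulrDl -splitr.
  rewrite mulrCA gtr_pMr// ltr_pdivrMr; lra.
apply: le_trans (_ : K * \sum_(i < p)
  (`|f (y i) - f (x i)| + `|g (y i) - g (x i)|) <= _).
  by rewrite mulr_sumr; apply: ler_sum => i _; have [? ? ?] := xy i; exact: hfg.
by rewrite ler_wpM2l// big_split/= lerD// ltW.
Qed.

Lemma absolutely_continuous_continuous (R : realType) (f : R -> R) :
  (forall a b, absolutely_continuous_on a b f) -> continuous f.
Proof.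
move=> acf x; apply/cvgrPdist_lt => e e0.
have [d d0 H] := acf (x - 1) (x + 1) e e0.
have main u v : x - 1 <= u -> u <= v -> v <= x + 1 -> v - u < d ->
    `|f v - f u| < e.
  move=> xu uv vx vud.
  have := H 1%N (fun=> u) (fun=> v); rewrite !big_ord1; apply => //.
  by move=> i j _ _ _; rewrite !ord1.
have m0 : 0 < Num.min 1 d by rewrite lt_min d0 ltr01.
near=> t.
have : `|x - t| < Num.min 1 d.
  by near: t; apply: cvgr_dist_lt => //; exact: cvg_id.
rewrite lt_min ltr_distlC ltr_distl => /andP[/andP[t1 t2] /andP[t3 t4]].
have [xt|tx] := leP x t; first by rewrite distrC main//; lra.
by rewrite main//; lra.
Unshelve. all: by end_near. Qed.

(** Outer regularity of the Lebesgue measure. *)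
Lemma null_set_open_cover (R : realType) (N : set R) (e : R) : 0 < e ->
  (@completed_lebesgue_measure R).-negligible N ->
  exists U : set R, [/\ open U, N `<=` U & (@lebesgue_measure R U < e%:E)%E].
Proof.
move=> e0 /completed_negligible[A [mA A0 NA]].
have Afin : (@lebesgue_measure R A < +oo)%E by rewrite [X in (X < _)%E]A0.
have [U [oU AU muU]] := lebesgue_regularity_outer mA Afin e0.
exists U; split => //; first exact: subset_trans AU.
rewrite -(setDUK AU); apply: le_lt_trans muU.
have mUA : measurable (U `\` A : set (measurableTypeR R)).
  by apply: measurableD => //; exact: open_measurable.
apply: le_trans (@measureU2 _ _ _ (@lebesgue_measure R) _ _ mA mUA) _.
by rewrite [X in (X + _)%E]A0 add0e.
Qed.

(** Finite families of intervals are lists ordered from left to right, so that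
    families over adjacent intervals are combined by concatenation.  Consecutive
    members may share an endpoint. *)
Definition ordered_intervals_in (R : realType) (U : set R) (u v : R)
    (s : seq (R * R)) : Prop :=
  pairwise (fun p q => p.2 <= q.1) s /\
  forall p, p \in s -> [/\ u <= p.1, p.1 <= p.2, p.2 <= v &
    `[p.1, p.2] `<=` U].

Lemma ordered_intervals_cat (R : realType) (U : set R) u v w s1 s2 :
  u <= v -> v <= w ->
  ordered_intervals_in U u v s1 -> ordered_intervals_in U v w s2 ->
  @ordered_intervals_in R U u w (s1 ++ s2).
Proof.
move=> uv vw [p1 i1] [p2 i2]; split.
  rewrite pairwise_cat p1 p2 !andbT; apply/allrelP => p q /i1[_ _ pv _].
  by case/i2 => vq _ _ _; exact: le_trans vq.
move=> p; rewrite mem_cat => /orP[/i1|/i2] [h1 h2 h3 h4]; split => //.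
  exact: le_trans vw.
exact: le_trans h1.
Qed.

Lemma ordered_intervals_trivIset (R : realType) (U : set R) u v s :
  ordered_intervals_in U u v s ->
  trivIset setT (fun i : 'I_(size s) =>
    `](nth (0, 0) s i).1, (nth (0, 0) s i).2[%classic).
Proof.
move=> [/(pairwiseP (0, 0)) ord _].
apply/trivIsetP => /= i j _ _ ij.
wlog {ij} ij : i j / (i < j)%N.
  move=> H; have := ij; rewrite -val_eqE/= neq_ltn => /orP[|]; first exact: H.
  by rewrite setIC; exact: H.
rewrite -subset0 => x [/=]; rewrite !in_itv/= => /andP[_ xi] /andP[jx _].
have := ord i j; rewrite !inE => /(_ (ltn_ord _) (ltn_ord _) ij).
by rewrite leNgt (lt_trans jx xi).
Qed.

Lemma ordered_intervals_length (R : realType) (U : set R) u v s : open U ->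
  ordered_intervals_in U u v s ->
  ((\sum_(i < size s) ((nth (0, 0) s i).2 - (nth (0, 0) s i).1))%:E <=
   @lebesgue_measure R U)%E.
Proof.
move=> oU os; have tI := ordered_intervals_trivIset os.
set I := fun i : 'I_(size s) => (_ : set R) in tI.
have mI i : measurable (I i : set (measurableTypeR R)) by exact: measurable_itv.
have sI (i : 'I_(size s)) :
    (nth (0, 0) s i).1 <= (nth (0, 0) s i).2 /\ I i `<=` U.
  have [_ /(_ _ (mem_nth (0, 0) (ltn_ord i)))[_ ? _ sU]] := os; split => //.
  by apply: subset_trans sU; exact: subset_itvW.
apply: (@le_trans _ _ (@lebesgue_measure R (\big[setU/set0]_i I i))).
  rewrite measure_bigsetU_ord//= -sumEFin; apply: lee_sum => i _.
  have [xyi _] := sI i.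
  rewrite [leRHS]lebesgue_measure_itv/= lte_fin; case: ltP => // yx.
  by rewrite lee_fin subr_le0.
apply: le_measure; rewrite ?inE//.
- exact: bigsetU_measurable.
- exact: open_measurable.
- apply: (big_ind (fun A : set R => A `<=` U)) => //.
  + by move=> A B AU BU x [/AU|/BU].
  + by move=> i _; exact: (sI i).2.
Qed.

(** Derivative at the tag [t] controls the increment over any small interval
    that contains [t], by splitting it at [t]. *)
Lemma is_derive_ge0_increment (R : realType) (f : R -> R) (t d e : R) :
  0 < e -> is_derive t 1 f d -> 0 <= d ->
  exists2 r, 0 < r & forall u v, u <= t -> t <= v -> v - u < r ->
    f u - f v <= e * (v - u).
Proof.
move=> e0 fd d0.
have cf : h^-1 *: (f (h + t) - f t) @[h --> 0^'] --> d.
  have := @ex_derive _ _ _ _ _ _ _ fd; rewrite /derivable.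
  rewrite -(@derive_val _ _ _ _ _ _ _ fd) /derive => cf.
  apply: cvg_trans cf; apply: near_eq_cvg; near=> h.
  by rewrite /= [h *: 1]mulr1.
have /cvgrPdist_lt/(_ _ e0) := cf.
rewrite near_withinE => /nbhs_ballP[r /= r0 H].
exists r => // u v ut tv vur.
have loc w : `|w - t| < r -> w != t -> - e < (f w - f t) / (w - t).
  move=> wr wt.
  have := H (w - t); rewrite /ball/= sub0r normrN => /(_ wr).
  rewrite subr_eq0 => /(_ wt); rewrite subrK /GRing.scale/= mulrC ltr_distl.
  by move=> /andP[_]; lra.
have R1 : f t - f v <= e * (v - t).
  have [->|vt] := eqVneq v t; first by rewrite !subrr mulr0.
  have vt0 : 0 < v - t by rewrite subr_gt0 lt_neqAle eq_sym vt.
  have := loc v; rewrite gtr0_norm// => /(_ _ vt); rewrite ltr_pdivlMr//.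
  by move=> H1; have := H1 ltac:(lra); lra.
have R2 : f u - f t <= e * (t - u).
  have [->|vt] := eqVneq u t; first by rewrite !subrr mulr0.
  have vt0 : u - t < 0 by rewrite subr_lt0 lt_neqAle vt.
  have := loc u; rewrite ltr0_norm// => /(_ _ vt); rewrite ltr_ndivlMr//.
  by move=> H1; have := H1 ltac:(lra); lra.
by move: R1 R2; rewrite !mulrBr; lra.
Unshelve. all: by end_near. Qed.

(** Cover the exceptional null set by an open set [U] of measure less than the
    modulus of absolute continuity.  A small interval whose tag is outside [U]
    loses at most [e'] times its length, because its tag has a nonnegative
    derivative; the intervals whose tag is in [U] can be taken inside [U], so
    absolute continuity bounds their total contribution.  The additive property
    [P] records both kinds of loss, and the tagged partition is provided by
    [interval_additive_induction]. *)
Lemma absolutely_continuous_nondecreasing (R : realType) (a b : R)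
    (f : R -> R) : a <= b -> absolutely_continuous_on a b f ->
  {ae @completed_lebesgue_measure R, forall t : R, a < t -> t <= b ->
    exists2 d : R, is_derive t 1 f d & 0 <= d} ->
  f a <= f b.
Proof.
move=> ab acf aef.
apply/ler_addgt0Pr => e e0.
(* The + 1 covers the case a = b; e' * (b - a) stays below e / 2. *)
pose e' := e / 2 / (b - a + 1).
have e'0 : 0 < e' by rewrite !divr_gt0//; lra.
have [d d0 Hd] := acf (e / 2) ltac:(by rewrite divr_gt0).
have [U [oU NU muU]] := null_set_open_cover d0 (completed_ae2 aef
  (completed_ae_neq a) (fun t h ta => conj h ta)).
pose P u v := exists2 s, ordered_intervals_in U u v s &
  f u - f v <= e' * (v - u) +
    \sum_(i < size s) `|f (nth (0, 0) s i).2 - f (nth (0, 0) s i).1|.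
have sumE (s : seq (R * R)) :
    \sum_(i < size s) `|f (nth (0, 0) s i).2 - f (nth (0, 0) s i).1| =
    \sum_(p <- s) `|f p.2 - f p.1| by rewrite (big_nth (0, 0)) big_mkord.
suff [s os fab] : P a b.
  have : \sum_(i < size s)
      `|f (nth (0, 0) s i).2 - f (nth (0, 0) s i).1| < e / 2.
    apply: (Hd _ (fun i => (nth (0, 0) s i).1) (fun i => (nth (0, 0) s i).2)).
    - move=> i; have [_ /(_ _ (mem_nth (0, 0) (ltn_ord i)))[? ? ? _]] := os.
      by split.
    - exact: ordered_intervals_trivIset os.
    - rewrite -lte_fin; apply: le_lt_trans muU.
      exact: ordered_intervals_length os.
  have : e' * (b - a) <= e / 2.
    rewrite /e' mulrAC ler_pdivrMr ?ler_pM2l//; lra.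
  lra.
apply: (@interval_additive_induction _ P) => //.
- move=> u v w uv vw [s1 os1 h1] [s2 os2 h2]; exists (s1 ++ s2).
    exact: ordered_intervals_cat os2.
  move: h1 h2; rewrite !sumE big_cat/=.
  rewrite !mulrBr; lra.
move=> x xab.
have [Ux|Ux] := pselect (U x).
  have /nbhs_ballP[r /= r0 xr] : nbhs x U by exact: open_nbhs_nbhs.
  exists r => // u v au ux xv vb vur; exists [:: (u, v)].
    split => // p; rewrite inE => /eqP-> /=; split => //.
      exact: le_trans xv.
    move=> y /=; rewrite in_itv/= => /andP[uy yv]; apply: xr.
    have xry : x - r < y by clear -ux vur uy yv xv; lra.
    have yxr : y < x + r by clear -ux vur uy yv xv; lra.
    by rewrite /ball/= ltr_distlC xry.
  rewrite big_ord1/=.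
  have : 0 <= e' * (v - u) by apply: mulr_ge0; [exact: ltW|lra].
  by have := ler_norm (f u - f v); rewrite distrC; lra.
have [d' fd' d'0] : exists2 d : R, is_derive x 1 f d & 0 <= d.
  apply: contrapT => nd; apply: Ux; apply: NU => /= -[dx xa].
  move/andP: xab => [ax xb]; apply/nd/dx => //.
  by rewrite lt_neqAle eq_sym xa.
have [r r0 H] := is_derive_ge0_increment e'0 fd' d'0.
exists r => // u v _ ux xv _ vur; exists [::].
  by split.
by rewrite big_ord0 addr0 H.
Qed.

(** * The weight and the Picard images *)

Lemma expR_lipschitz (R : realType) (M x y : R) : x <= M -> y <= M ->
  `|expR y - expR x| <= expR M * `|y - x|.
Proof.
wlog xy : x y / x <= y.
  move=> H xM yM; have [/H|/ltW/H] := leP x y; first exact.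
  by rewrite distrC [X in _ * X]distrC; exact.
move=> xM yM; rewrite !ger0_norm ?subr_ge0 ?ler_expR//.
apply: (@le_trans _ _ (expR y * (y - x))); last first.
  by rewrite ler_wpM2r ?subr_ge0// ler_expR.
have -> : expR x = expR y * expR (x - y) by rewrite -expRD addrC subrK.
rewrite -[X in X - _]mulr1 -mulrBr ler_wpM2l ?expR_ge0//.
by have := expR_ge1Dx (x - y); lra.
Qed.

(** The weight is [expR (c * G)] for the primitive [G] of [f].  It replaces the
    inequality of Gronwall: it solves w' = c f w with initial value 1. *)
Lemma gronwall_weight (R : realType) (t0 c : R) (f : R -> R) : 0 <= c ->
  locally_integrable_from t0 f -> (forall t, t0 <= t -> 0 <= f t) ->
  exists w : R -> R,
  [/\ forall t, t <= t0 -> w t = 1,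
      {homo w : s t / s <= t},
      forall a b, absolutely_continuous_on a b w &
      {ae @completed_lebesgue_measure R, forall t : R,
        t0 < t -> is_derive t 1 w (c * f t * w t)}].
Proof.
move=> c0 /primitive_exists[G [G0 acG dG]] f0.
have homoG : {homo G : s t / s <= t}.
  suff H s t : t0 <= s -> s <= t -> G s <= G t.
    move=> s t st; have [t0s|st0] := leP t0 s; first exact: H.
    have [t0t|tt0] := leP t0 t; last by rewrite !G0// ltW.
    by have := H t0 t (lexx _) t0t; rewrite (G0 t0)// (G0 s)// ltW.
  move=> ts st; apply: (absolutely_continuous_nondecreasing st (acG s t)).
  apply: (completed_ae2 dG dG) => u du _ su _; exists (f u).
    by apply: du; exact: le_lt_trans su.
  by apply: f0; exact: ltW (le_lt_trans ts su).
exists (fun t => expR (c * G t)); split.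
- by move=> t tt0; rewrite G0// mulr0 expR0.
- by move=> s t st; rewrite ler_expR ler_wpM2l// homoG.
- move=> a b; have M0 : 0 <= expR (c * G b) * c by rewrite mulr_ge0// expR_ge0.
  apply: (absolutely_continuous_dominated M0 (acG a b) (acG a b)).
  move=> x y ax xy yb.
  apply: le_trans (expR_lipschitz (M := c * G b) _ _) _.
  + by rewrite ler_wpM2l// homoG// (le_trans xy).
  + by rewrite ler_wpM2l// homoG.
  + rewrite -mulrBr normrM (ger0_norm c0) mulrA ler_wpM2l//.
    by rewrite lerDl.
- apply: (completed_ae2 dG dG) => t dt _ tt.
  have dGt := dt tt.
  have dcG : is_derive t 1 (fun s => c * G s) (c * f t).
    exact: (is_deriveZ c dGt).
  have := @is_derive1_comp _ expR (fun s => c * G s) _ _ _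
    (is_derive_expR _) dcG.
  by rewrite mulrC.
Qed.

(** Extension of the initial data by their value at [t0]. *)
Lemma continuous_stopped (R : realType) (t0 : R) (r : R -> R) :
  {within `]-oo, t0], continuous r} ->
  continuous (fun t => r (Num.min t t0)).
Proof.
move=> /subspace_continuousP rc x.
have xt0 : `]-oo, t0]%classic (Num.min x t0).
  by rewrite /= in_itv/= ge_min lexx orbT.
apply/cvgrPdist_lt => e e0.
have /cvgrPdist_lt/(_ _ e0) := rc _ xt0.
rewrite near_withinE => /nbhs_ballP[d /= d0 H].
near=> t.
have xt : `|x - t| < d by near: t; apply: cvgr_dist_lt => //; exact: cvg_id.
apply: H; last by rewrite /= in_itv/= ge_min lexx orbT.
rewrite /ball/=; apply: le_lt_trans xt.
rewrite /Num.min/Order.min; case: ltP => xt0'; case: ltP => tt0' //.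
- rewrite ler_norml; have := ler_norm (t - x); rewrite distrC => ?.
  by apply/andP; split; lra.
- rewrite ler_norml; have := ler_norm (x - t) => ?.
  by apply/andP; split; lra.
- by rewrite subrr normr0.
Unshelve. all: by end_near. Qed.

Lemma locally_measurable_comp (R : realType) (t0 : R) (phi alpha : R -> R) :
  continuous phi -> locally_measurable_from t0 alpha ->
  locally_measurable_from t0 (fun t => phi (alpha t)).
Proof.
move=> cphi malpha a b ta ab.
by apply: measurableT_comp (malpha a b ta ab); exact: continuous_measurable_fun.
Qed.

Lemma locally_integrable_sum (R : realType) (n : nat) (t0 : R)
    (f : 'I_n -> R -> R) :
  (forall k, locally_integrable_from t0 (f k)) ->
  locally_integrable_from t0 (fun t => \sum_(k < n) f k t).
Proof.
move=> fi a b ta ab.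
have -> : EFin \o (fun t => \sum_(k < n) f k t) =
    (fun t => \sum_(k < n) (f k t)%:E)%E.
  by apply/funext => t /=; rewrite sumEFin.
apply: integrable_sum => [|k _]; last exact: fi.
by apply: sub_caratheodory; exact: measurable_itv.
Qed.

(** One step of the Picard iteration, as a relation: these are the clauses of
    [cauchy_solution] with the unknown replaced by [phi] inside the delayed
    terms, so that [picard_image phi phi] is convertible to
    [cauchy_solution phi]. *)
Definition picard_image (R : realType) (n N : nat) (t0 : R)
    (F : 'I_n -> R -> 'M[R]_(n, N) -> R)
    (alpha : 'I_n -> 'I_N -> R -> R) (r : 'I_n -> R -> R)
    (phi Phi : 'I_n -> R -> R) : Prop :=
  [/\ forall k, continuous (Phi k),
      forall k a b, t0 <= a -> a <= b -> absolutely_continuous_on a b (Phi k),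
      {ae (@completed_lebesgue_measure R), forall t : R, t0 <= t -> forall k,
        is_derive t 1 (Phi k)
          (F k t (\matrix_(m < n, j < N) phi m (alpha m j t)))}
    & forall k t, t <= t0 -> Phi k t = r k t].

(** The image is the initial value, continued by r_k(t0), plus a primitive of
    the right-hand side that vanishes on the left of [t0]. *)
Lemma picard_image_exists (R : realType) (n N : nat) (t0 : R)
    (F : 'I_n -> R -> 'M[R]_(n, N) -> R)
    (alpha : 'I_n -> 'I_N -> R -> R) (r : 'I_n -> R -> R)
    (phi : 'I_n -> R -> R) :
  (forall k j, locally_measurable_from t0 (alpha k j)) ->
  (forall k, {within `]-oo, t0], continuous (r k)}) ->
  (forall psi : 'I_n -> 'I_N -> R -> R,
    (forall m j, locally_measurable_from t0 (psi m j)) ->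
    forall k, locally_integrable_from t0
      (fun t => F k t (\matrix_(m < n, j < N) psi m j t))) ->
  (forall k, continuous (phi k)) ->
  exists Phi, picard_image t0 F alpha r phi Phi.
Proof.
move=> alpha_meas r_cont LI phi_cont.
have psi_meas m j := locally_measurable_comp (phi_cont m) (alpha_meas m j).
have /choice[P HP] := fun k => primitive_exists (LI _ psi_meas k).
exists (fun k t => r k (Num.min t t0) + P k t); split.
- move=> k x; have [_ acP _] := HP k.
  by apply: cvgD; [exact: continuous_stopped|
    exact: absolutely_continuous_continuous].
- move=> k a b ta ab; have [_ acP _] := HP k.
  apply: (absolutely_continuous_dominated ler01 (acP a b) (acP a b)).
  move=> x y ax xy yb.
  have tx : t0 <= x by exact: le_trans ax.
  rewrite (min_r tx) (min_r (le_trans tx xy)) mul1r.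
  by rewrite [X in `|X|](_ : _ = P k y - P k x) ?lerDl//; lra.
- have aeP : {ae @completed_lebesgue_measure R, forall t : R, forall k,
      t0 < t -> is_derive t 1 (P k)
        (F k t (\matrix_(m < n, j < N) phi m (alpha m j t)))}.
    by apply: completed_ae_forall => k; have [_ _] := HP k.
  apply: (completed_ae2 aeP (completed_ae_neq t0)) => t dP tt0 t0t k.
  have {t0t tt0} tt : t0 < t by rewrite lt_neqAle eq_sym tt0.
  have dc := is_deriveD (is_derive_cst (r k t0) t 1) (dP k tt).
  rewrite add0r in dc.
  apply: near_eq_is_derive dc; near=> s.
  rewrite /= min_r//; apply: ltW; near: s; exact: lt_nbhsr.
- by move=> k t tt0; have [P0 _ _] := HP k; rewrite P0// addr0 min_l.
Unshelve. all: by end_near. Qed.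

(** By retardation and monotonicity of [w], the delayed differences at time [s]
    are at most [C * w s].  The n N terms of the Lipschitz bound and the factor
    2 n N in the growth rate of [w] then leave the factor 1/2. *)
Lemma picard_image_contraction (R : realType) (n N : nat) (t0 : R)
    (F : 'I_n -> R -> 'M[R]_(n, N) -> R)
    (alpha : 'I_n -> 'I_N -> R -> R) (r : 'I_n -> R -> R)
    (f : 'I_n -> R -> R) (w : R -> R)
    (phi psi Phi Psi : 'I_n -> R -> R) (C T : R) :
  (forall k t (u v : 'M[R]_(n, N)), t0 <= t ->
    `|F k t u - F k t v| <=
      f k t * \sum_(m < n) \sum_(j < N) `|u m j - v m j|) ->
  (forall k t, t0 <= t -> 0 <= f k t) ->
  (forall k j t, t0 <= t -> alpha k j t <= t) ->
  (forall t, t <= t0 -> w t = 1) ->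
  {homo w : s t / s <= t} ->
  (forall a b, absolutely_continuous_on a b w) ->
  {ae @completed_lebesgue_measure R, forall t : R, t0 < t ->
    is_derive t 1 w ((2 * n * N)%:R * (\sum_(k < n) f k t) * w t)} ->
  picard_image t0 F alpha r phi Phi ->
  picard_image t0 F alpha r psi Psi ->
  0 <= C ->
  (forall k t, t <= T -> `|phi k t - psi k t| <= C * w t) ->
  forall k t, t <= T -> `|Phi k t - Psi k t| <= C / 2 * w t.
Proof.
move=> L f0 Ret w1 homow acw dw imPhi imPsi C0.
move=> H k t tT.
have w0 s : 0 <= w s.
  rewrite (le_trans ler01)//; have [|/ltW] := leP s t0; first by move/w1->.
  by move/homow; rewrite w1.
have [tt0|tt] := leP t t0.
  have [_ _ _ Phir] := imPhi; have [_ _ _ Psir] := imPsi.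
  by rewrite Phir// Psir// subrr normr0 mulr_ge0// divr_ge0.
have pointwise s : t0 < s -> s <= t ->
    `|F k s (\matrix_(m, j) phi m (alpha m j s)) -
      F k s (\matrix_(m, j) psi m (alpha m j s))| <=
    C / 2 * ((2 * n * N)%:R * (\sum_(k < n) f k s) * w s).
  move=> ts st; apply: (le_trans (L _ _ _ _ (ltW ts))).
  apply: (@le_trans _ _ (f k s * \sum_(m < n) \sum_(j < N) (C * w s))).
    apply: ler_wpM2l; first exact/f0/ltW.
    apply: ler_sum => m _; apply: ler_sum => j _.
    have as_ : alpha m j s <= s by rewrite Ret// ltW.
    rewrite !mxE; apply: le_trans (H _ _ _) _.
      exact: le_trans as_ (le_trans st tT).
    by rewrite ler_wpM2l// homow.
  have -> : \sum_(m < n) \sum_(j < N) (C * w s) = (n * N)%:R * (C * w s).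
    by rewrite !sumr_const !card_ord -mulrnA mulnC mulr_natl.
  have fk : f k s <= \sum_(k < n) f k s.
    rewrite (bigD1 k)//= lerDl sumr_ge0// => i _; exact/f0/ltW.
  apply: (@le_trans _ _ ((\sum_(k < n) f k s) * ((n * N)%:R * (C * w s)))).
    by rewrite ler_wpM2r// !mulr_ge0.
  rewrite -mulnA natrM le_eqVlt; apply/orP; left; apply/eqP.
  by field.
(* Applied to (Phi, Psi) and to (Psi, Phi), this bounds the absolute value:
   C / 2 * w - (X - Y) has a nonnegative derivative and equals C / 2 at t0. *)
have onesided (X Y : 'I_n -> R -> R) (x y : 'I_n -> R -> R) :
    picard_image t0 F alpha r x X -> picard_image t0 F alpha r y Y ->
    (forall s, t0 < s -> s <= t ->
      F k s (\matrix_(m, j) x m (alpha m j s)) -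
      F k s (\matrix_(m, j) y m (alpha m j s)) <=
      C / 2 * ((2 * n * N)%:R * (\sum_(k < n) f k s) * w s)) ->
    X k t - Y k t <= C / 2 * w t.
  move=> [_ acX dX Xr] [_ acY dY Yr] Hxy.
  pose h := (C / 2) \*: w - (X k - Y k).
  have hE s : h s = C / 2 * w s - (X k s - Y k s) by [].
  suff : h t0 <= h t.
    rewrite !hE Xr// Yr// subrr subr0 w1// mulr1.
    have : 0 <= C / 2 by rewrite divr_ge0.
    lra.
  have K0 : 0 <= C / 2 + 1 by rewrite addr_ge0// divr_ge0.
  have acD : absolutely_continuous_on t0 t (X k - Y k).
    apply: (absolutely_continuous_dominated ler01
      (acX k t0 t (lexx _) (ltW tt)) (acY k t0 t (lexx _) (ltW tt))).
    move=> a b _ _ _.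
    rewrite mul1r !fctE; apply: le_trans (ler_normB _ _).
    by rewrite le_eqVlt; apply/orP; left; apply/eqP; congr `|_|; ring.
  apply: (absolutely_continuous_nondecreasing (ltW tt)).
    apply: (absolutely_continuous_dominated K0 (acw t0 t) acD) => a b _ _ _.
    rewrite !hE.
    rewrite [X in `|X|](_ : _ = C / 2 * (w b - w a) -
      (X k b - Y k b - (X k a - Y k a))); last by ring.
    apply: le_trans (ler_normB _ _) _.
    rewrite normrM (ger0_norm (_ : 0 <= C / 2)) ?divr_ge0//.
    set A := `|w b - w a|; set B := `|_ - _|.
    have A0 : 0 <= A by exact: normr_ge0.
    have B0 : 0 <= B by exact: normr_ge0.
    have c0 : 0 <= C / 2 by rewrite divr_ge0.
    have := mulr_ge0 c0 B0.
    rewrite !mulrDl !mulrDr; lra.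
  apply: (completed_ae2 (completed_ae2 dX dY (fun s p q => conj p q)) dw).
  move=> s [dXs dYs] dws ts st.
  exists (C / 2 * ((2 * n * N)%:R * (\sum_(k < n) f k s) * w s) -
    (F k s (\matrix_(m, j) x m (alpha m j s)) -
      F k s (\matrix_(m, j) y m (alpha m j s)))); last first.
    by rewrite subr_ge0 Hxy.
  exact: is_deriveB (is_deriveZ _ (dws ts))
    (is_deriveB (dXs (ltW ts) k) (dYs (ltW ts) k)).
rewrite ler_norml; apply/andP; split.
  rewrite lerNl opprB; apply: (onesided Psi Phi psi phi) => // s ts st.
  by apply: le_trans (pointwise s ts st); rewrite distrC ler_norm.
apply: (onesided Phi Psi phi psi) => // s ts st.
by apply: le_trans (pointwise s ts st); rewrite ler_norm.
Qed.

(** A common bound on a whole half-line: the functions agree on the left of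
    [t0] and are continuous on the compact [`[t0, T]]. *)
Lemma continuous_bounded_from (R : realType) (n : nat) (t0 T : R)
    (phi psi : 'I_n -> R -> R) :
  (forall k, continuous (phi k)) -> (forall k, continuous (psi k)) ->
  (forall k t, t <= t0 -> phi k t = psi k t) ->
  exists2 C : R, 0 <= C & forall k t, t <= T -> `|phi k t - psi k t| <= C.
Proof.
move=> cphi cpsi eq0.
have [tT|Tt] := leP t0 T; last first.
  exists 0 => // k t tT; rewrite eq0 ?subrr ?normr0//.
  exact: le_trans tT (ltW Tt).
have bk k : exists c : R, forall t, t <= T -> `|phi k t - psi k t| <= c.
  have cn : {within `[t0, T], continuous (fun t => `|phi k t - psi k t|)}.
    apply: continuous_subspaceT => x.
    by apply: cvg_norm; apply: cvgB; [exact: cphi|exact: cpsi].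
  have [c _ Hc] := EVT_max tT cn.
  exists `|phi k c - psi k c| => t tT'.
  have [tt0|/ltW t0t] := leP t t0; first by rewrite eq0// subrr normr0.
  by apply: Hc; rewrite in_itv/= t0t.
have /choice[c Hc] := bk.
exists (\sum_(k < n) `|c k|); first exact: sumr_ge0.
move=> k t tT'; apply: le_trans (Hc _ _ tT') _.
by rewrite (bigD1 k)//= (le_trans (ler_norm _))// lerDl sumr_ge0.
Qed.

Lemma geometric_lt (R : realType) (K e : R) : 0 < e ->
  exists p : nat, K / 2 ^+ p < e.
Proof.
move=> e0; exists (Num.truncn (K / e)).+1.
rewrite ltr_pdivrMr ?exprn_gt0// mulrC -ltr_pdivrMr//.
apply: lt_le_trans (truncnS_gt _) _.
by rewrite -natrX ler_nat ltnW// ltn_expl.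
Qed.

Lemma eq0_geometric_bound (R : realType) (x K : R) :
  (forall p : nat, `|x| <= K / 2 ^+ p) -> x = 0.
Proof.
move=> H; apply/eqP; rewrite -normr_le0 leNgt; apply/negP => x0.
have [p] := geometric_lt K x0.
by rewrite ltNge H.
Qed.

(** * Existence and uniqueness *)

Theorem theorem3p1 (R : realType) (n N : nat) (hn : (0 < n)%N) (hN : (0 < N)%N)
    (t0 : R) (F : 'I_n -> R -> 'M[R]_(n, N) -> R)
    (alpha : 'I_n -> 'I_N -> R -> R) (r : 'I_n -> R -> R)
    (F_int : forall k (u : 'M[R]_(n, N)),
      locally_integrable_from t0 (fun t => F k t u))
    (F_cont : forall k t, t0 <= t -> continuous (F k t))
    (alpha_meas : forall k j, locally_measurable_from t0 (alpha k j))
    (r_cont : forall k, {within `]-oo, t0], continuous (r k)})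
    (L : exists2 f : 'I_n -> R -> R,
      forall k, locally_integrable_from t0 (f k) &
      forall k t (u v : 'M[R]_(n, N)), t0 <= t ->
        `|F k t u - F k t v| <=
          f k t * \sum_(m < n) \sum_(j < N) `|u m j - v m j|)
    (LI : forall psi : 'I_n -> 'I_N -> R -> R,
      (forall m j, locally_measurable_from t0 (psi m j)) ->
      forall k, locally_integrable_from t0
        (fun t => F k t (\matrix_(m < n, j < N) psi m j t)))
    (Ret : forall k j t, t0 <= t -> alpha k j t <= t) :
  exists! phi : 'I_n -> R -> R, cauchy_solution t0 F alpha r phi.
Proof.
have [f fi Lf] := L.
(* Compare, in the Lipschitz bound, the all-ones matrix with the zero one. *)
have f0 k t : t0 <= t -> 0 <= f k t.
  move=> tt; have := Lf k t (const_mx 1) 0 tt.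
  under eq_bigr do under eq_bigr do rewrite !mxE subr0 normr1.
  move=> /(le_trans (normr_ge0 _)); rewrite !sumr_const !card_ord -mulrnA.
  by rewrite pmulr_lge0// ltr0n muln_gt0 hN.
have sf0 t : t0 <= t -> 0 <= \sum_(k < n) f k t.
  by move=> tt; rewrite sumr_ge0// => k _; exact: f0.
have [w [w1 homow acw dw]] :=
  gronwall_weight (ler0n R (2 * n * N)) (locally_integrable_sum fi) sf0.
have w_ge1 t : 1 <= w t.
  by have [/w1->//|/ltW/homow] := leP t t0; rewrite w1.
have contr phi psi Phi Psi C T :=
  @picard_image_contraction R n N t0 F alpha r f w phi psi Phi Psi C T
    Lf f0 Ret w1 homow acw dw.
have /choice[S imS] : forall phi : 'I_n -> R -> R, exists Phi,
    (forall k, continuous (phi k)) -> picard_image t0 F alpha r phi Phi.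
  move=> phi.
  have [cphi|ncphi] := pselect (forall k, continuous (phi k)).
    have [Phi imPhi] := picard_image_exists alpha_meas r_cont LI cphi.
    by exists Phi.
  by exists phi => /ncphi.
(* The iteration starts from the initial data frozen at time t0. *)
pose it p := iter p S (fun k t => r k (Num.min t t0)).
have cit p k : continuous (it p k).
  elim: p k => [|p IH] k; first exact: continuous_stopped.
  by have [cS _ _ _] := imS _ IH; exact: cS.
have itr p k t : t <= t0 -> it p k t = r k t.
  case: p => [|p] tt0; first by rewrite /it/= min_l.
  by have [_ _ _ Sr] := imS _ (cit p); exact: Sr.
(* Summing the geometric bounds C / 2 ^+ p * w t on consecutive iterates. *)
have bound T : exists2 C : R, 0 <= C & forall p q k t, t <= T ->
    `|it p k t - it (p + q)%N k t| <= C / 2 ^+ p * w t.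
  have [C C0 HC] := continuous_bounded_from T (cit 0%N) (cit 1%N)
    (fun k t tt0 => etrans (itr 0%N k t tt0) (esym (itr 1%N k t tt0))).
  have step p k t : t <= T -> `|it p k t - it p.+1 k t| <= C / 2 ^+ p * w t.
    elim: p k t => [|p IH] k t tT.
      rewrite expr0 divr1; apply: le_trans (HC _ _ tT) _.
      by rewrite ler_peMr.
    rewrite exprSr invfM mulrA.
    apply: (contr (it p) (it p.+1) _ _ _ T (imS _ (cit p))
      (imS _ (cit p.+1))) => //.
    by rewrite divr_ge0// exprn_ge0.
  exists (2 * C) => [|p q k t tT]; first by rewrite mulr_ge0.
  suff : `|it p k t - it (p + q)%N k t| <=
      2 * C * (1 / 2 ^+ p - 1 / 2 ^+ (p + q)) * w t.
    move/le_trans; apply; rewrite ler_wpM2r ?(le_trans ler01)//.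
    rewrite ler_wpM2l ?mulr_ge0// div1r gerBl divr_ge0// exprn_ge0//.
  elim: q => [|q IH]; first by rewrite addn0 !subrr normr0 mulr0 mul0r.
  apply: le_trans (ler_distD (it (p + q)%N k t) _ _) _.
  apply: le_trans (lerD IH _) _.
    by rewrite addnS; exact: step.
  rewrite -mulrDl ler_wpM2r ?(le_trans ler01)//.
  rewrite addnS exprS le_eqVlt; apply/orP; left; apply/eqP; field.
  by rewrite !expf_neq0//.
pose phi k t := limn (fun p => it p k t).
have itcvg k t : (fun p => it p k t) @ \oo --> phi k t.
  have [C C0 HC] := bound t.
  apply/cauchy_cvgP; apply: cauchy_exP => e e0.
  have [p pe] := geometric_lt (C * w t) e0.
  exists (it p k t); exists p => // q /= pq.
  rewrite /ball/= -(subnKC pq); apply: le_lt_trans (HC p _ k t (lexx _)) _.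
  by rewrite mulrAC.
have lim_bound T : exists2 C : R, 0 <= C & forall p k t, t <= T ->
    `|it p k t - phi k t| <= C / 2 ^+ p * w t.
  have [C C0 HC] := bound T; exists C => // p k t tT.
  have cv : (fun q => `|it p k t - it (p + q)%N k t|) @ \oo -->
      `|it p k t - phi k t|.
    apply: cvg_norm; apply: cvgB; first exact: cvg_cst.
    have := itcvg k t; rewrite -(cvg_shiftn p (fun q => it q k t)).
    by under eq_fun do rewrite addnC.
  apply: (closed_cvg (fun y => y <= C / 2 ^+ p * w t) _ _ _ cv).
    exact: closed_le.
  by apply: nearW => q; exact: HC.
have cphi k : continuous (phi k).
  move=> x.
  have [C C0 HC] := lim_bound (x + 1).
  apply/cvgrPdist_lt => e e0.
  have e30 : 0 < e / 3 by rewrite divr_gt0.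
  have [p pe] := geometric_lt (C * w (x + 1)) e30.
  have near_it y : y <= x + 1 -> `|it p k y - phi k y| < e / 3.
    move=> yx; apply: le_lt_trans (HC p k y yx) (le_lt_trans _ pe).
    rewrite [leRHS]mulrAC ler_wpM2l ?homow// divr_ge0// exprn_ge0//.
  have dist3 (a b c d : R) : `|a - b| < e / 3 -> `|b - c| < e / 3 ->
      `|c - d| < e / 3 -> `|a - d| < e.
    by have := ler_distD b a d; have := ler_distD c b d; lra.
  near=> y.
  have yx : y <= x + 1 by apply: ltW; near: y; apply: lt_nbhsl; rewrite ltrDl.
  have h1 := near_it x (ltW (ltr_pwDr ltr01 (lexx x))).
  have h2 := near_it y yx.
  have h3 : `|it p k x - it p k y| < e / 3.
    by near: y; apply: cvgr_dist_lt => //; exact: cit.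
  by apply: dist3 h3 h2; rewrite distrC.
have phir k t : t <= t0 -> phi k t = r k t.
  move=> tt0; have [C C0 HC] := lim_bound t0.
  apply/eqP; rewrite -subr_eq0; apply/eqP/(@eq0_geometric_bound _ _ C) => p.
  by have := HC p k t tt0; rewrite itr// distrC w1// mulr1.
have solphi : cauchy_solution t0 F alpha r phi.
  (* Both phi and its image are within O(2 ^- p) of the iterate p.+1. *)
  suff SE : S phi = phi by have := imS _ cphi; rewrite SE.
  apply/funext => k; apply/funext => t.
  have [C C0 HC] := lim_bound t.
  apply/eqP; rewrite -subr_eq0; apply/eqP.
  apply: (@eq0_geometric_bound _ _ (C * w t)) => p.
  rewrite mulrAC.
  have H1 := HC p.+1 k t (lexx _).
  have H2 : `|it p.+1 k t - S phi k t| <= C / 2 ^+ p / 2 * w t.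
    apply: (contr (it p) phi _ _ _ t (imS _ (cit p)) (imS _ cphi)) => //.
    - by rewrite divr_ge0// exprn_ge0.
    - by move=> m s st; exact: HC.
  apply: le_trans (ler_distD (it p.+1 k t) _ _) _.
  rewrite distrC; apply: le_trans (lerD H2 H1) _.
  rewrite -mulrDl ler_wpM2r ?(le_trans ler01)//.
  rewrite exprS le_eqVlt; apply/orP; left; apply/eqP; field.
  by rewrite expf_neq0.
exists phi; split => // psi solpsi.
have [cpsi _ _ psir] := solpsi.
apply/funext => k; apply/funext => t.
have [C C0 HC] := continuous_bounded_from t cphi cpsi
  (fun k t tt0 => etrans (phir k t tt0) (esym (psir k t tt0))).
apply/eqP; rewrite -subr_eq0; apply/eqP.
apply: (@eq0_geometric_bound _ _ (C * w t)) => p.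
rewrite mulrAC.
(* The induction on p needs the bound on the whole half-line up to t. *)
suff : forall s k, s <= t -> `|phi k s - psi k s| <= C / 2 ^+ p * w s by exact.
elim: p => [|p IH] s m st.
  by rewrite expr0 divr1 (le_trans (HC _ _ st))// ler_peMr.
rewrite exprSr invfM mulrA.
apply: (contr phi psi _ _ _ t solphi solpsi) => //.
- by rewrite divr_ge0// exprn_ge0.
- by move=> i u ut; exact: IH.
Unshelve. all: by end_near. Qed.
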